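(* Let $(M,g_{ab})$ be a connected Einstein pseudo-Riemannian manifold of dimension $n\ge3$, let $Y_{ab}$ be a conformal Killing--Yano 2-form with associated vector field $\xi$, and let $(M,g_{ab},u,Y_{ab},\xi^a[Y],\lambda)$ be a CKY--RS structure. Put $\phi=e^{-u}$ and let $\alpha\in\mathbb{R}$ be the constant with $\mathcal{L}_\xi\phi=\alpha\phi$. (i) If $M$ is compact and $g_{ab}$ is Riemannian, then $\alpha=0$. (ii) If $\xi$ has a periodic orbit, i.e. there are $p_0\in M$ and $T>0$ such that $\Phi_T(p_0)=p_0$, where $\Phi_t$ is the flow of $\xi$, then $\alpha=0$. In both cases $\phi$ is therefore invariant under the flow of $\xi$.
   Context: Einstein: $R_{ab}=\Lambda g_{ab}$ with $\Lambda$ constant. Compact means compact without boundary. Conformal Killing--Yano (CKY) 2-form: a smooth 2-form $Y_{ab}$ with $\nabla_cY_{ab}=g_{ca}\xi_b-g_{cb}\xi_a+z_{abc}$, where $z_{abc}$ is totally antisymmetric and $\xi_a=\frac{1}{n-1}\nabla^bY_{ba}$; $\xi^a=\xi^a[Y]$ is its associated vector field. CKY--RS structure $(M,g_{ab},u,Y_{ab},\xi^a[Y],\lambda)$: $u\in C^\infty(M)$, $\lambda\in\mathbb{R}$, and $\tilde g_{ab}=e^{2u}g_{ab}$ satisfies $\tilde R_{ab}+\frac12\mathcal{L}_{\xi}\tilde g_{ab}=\lambda\tilde g_{ab}$ with $\xi=\xi[Y]$, $\tilde R_{ab}$ being the Ricci tensor of $\tilde g$. On an Einstein background $\xi$ is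 a Killing field of $g$, $\tilde R_{ab}=c\,\tilde g_{ab}$ with $c=\lambda-\xi(u)$ constant, and $\alpha=c-\lambda$. *)

(* Defs.v *)
From HB Require Import structures.
From mathcomp Require Import all_boot all_order all_algebra.
From mathcomp Require Import all_classical all_reals all_analysis.

Set Implicit Arguments.
Unset Strict Implicit.
Unset Printing Implicit Defensive.

Import Order.TTheory GRing.Theory Num.Theory.
Import numFieldNormedType.Exports.

Local Open Scope classical_set_scope.
Local Open Scope ring_scope.

(* Geometry is written in local coordinates with respect to an atlas: a tensor
   field is the family of its component arrays, indexed by a chart and a point
   and subject to the usual transformation law on chart overlaps. Charts, their
   inverses and component arrays are total functions; their values outside the
   relevant chart domain are never constrained or used. *)

(** * Smooth manifolds *)

(* For U open: f is C^(k+1) on U iff it is (Frechet) differentiable on U and all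
   its first partial derivatives are C^k on U. *)
Fixpoint Ck_on (R : realType) (n : nat) (k : nat) (U : set 'rV[R]_n)
    (f : 'rV[R]_n -> R) : Prop :=
  if k is k'.+1 then
    (forall x, U x -> differentiable f x) /\
    (forall i : 'I_n, Ck_on k' U (fun x => 'D_('e_i) f x))
  else forall x, U x -> {for x, continuous f}.

Definition smooth_on (R : realType) (n : nat) (U : set 'rV[R]_n)
    (f : 'rV[R]_n -> R) : Prop :=
  forall k, Ck_on k U f.

(* Without boundary: chart images are open subsets of R^n. *)
Record smooth_manifold (R : realType) (n : nat) := SmoothManifold {
  carrier :> topologicalType;
  manifold_hausdorff : hausdorff_space carrier;
  manifold_second_countable : @second_countable carrier;
  chart_index : Type;
  chart_dom : chart_index -> set carrier;
  chart_codom : chart_index -> set 'rV[R]_n;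
  chart : chart_index -> carrier -> 'rV[R]_n;
  chart_inv : chart_index -> 'rV[R]_n -> carrier;
  chart_dom_open : forall a, open (chart_dom a);
  chart_codom_open : forall a, open (chart_codom a);
  chart_in_codom : forall a p, chart_dom a p -> chart_codom a (chart a p);
  chart_inv_in_dom :
    forall a x, chart_codom a x -> chart_dom a (chart_inv a x);
  chartK : forall a p, chart_dom a p -> chart_inv a (chart a p) = p;
  chart_invK : forall a x, chart_codom a x -> chart a (chart_inv a x) = x;
  chart_continuous :
    forall a p, chart_dom a p -> {for p, continuous (chart a)};
  chart_inv_continuous :
    forall a x, chart_codom a x -> {for x, continuous (chart_inv a)};
  chart_cover : forall p, exists a, chart_dom a p;
  chart_transition : forall a b (j : 'I_n),
    smooth_on (chart a @` (chart_dom a `&` chart_dom b))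
              (fun x => chart b (chart_inv a x) ord0 j)
}.

Section Tensors.
Context {R : realType} {n : nat} {M : smooth_manifold R n}.
Implicit Types (a b : chart_index M) (p : M) (i j k l c : 'I_n).

Definition smooth_fun (f : M -> R) : Prop :=
  forall a, smooth_on (chart_codom a) (f \o chart_inv a).

(* (d/dx_a^i) f at p *)
Definition pd a i (f : M -> R) p : R :=
  'D_('e_i) (f \o chart_inv a) (chart a p).

(* entry (i, k) is dx_b^k / dx_a^i *)
Definition transition_jacobian a b p : 'M[R]_n :=
  \matrix_(i, k) pd a i (fun q => chart b q ord0 k) p.

Definition vfield := chart_index M -> M -> 'rV[R]_n.
Definition tensor02 := chart_index M -> M -> 'M[R]_n.

Definition is_smooth_tensor02 (T : tensor02) : Prop :=
  (forall a i j, smooth_on (chart_codom a) ((fun q => T a q i j) \o chart_inv a))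
  /\ (forall a b p, chart_dom a p -> chart_dom b p ->
        T a p = transition_jacobian a b p *m T b p
                *m (transition_jacobian a b p)^T).

(** * Pseudo-Riemannian geometry *)

(* The signature is then automatically constant on a connected manifold. *)
Definition is_pseudo_metric (g : tensor02) : Prop :=
  [/\ is_smooth_tensor02 g,
      forall a p, chart_dom a p -> (g a p)^T = g a p
    & forall a p, chart_dom a p -> g a p \in unitmx].

Definition is_riemannian (g : tensor02) : Prop :=
  forall a p, chart_dom a p ->
    forall v : 'rV[R]_n, v != 0 -> 0 < (v *m g a p *m v^T) ord0 ord0.

(* Gamma^k_ij *)
Definition christoffel (g : tensor02) a k i j p : R :=
  2^-1 * \sum_l invmx (g a p) k l *
    (pd a i (fun q => g a q j l) p + pd a j (fun q => g a q i l) p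
     - pd a l (fun q => g a q i j) p).

(* R^k_lij = d_i Gamma^k_jl - d_j Gamma^k_il
             + Gamma^k_im Gamma^m_jl - Gamma^k_jm Gamma^m_il *)
Definition riemann (g : tensor02) a k l i j p : R :=
  pd a i (christoffel g a k j l) p - pd a j (christoffel g a k i l) p
  + \sum_m (christoffel g a k i m p * christoffel g a m j l p
            - christoffel g a k j m p * christoffel g a m i l p).

(* R_ij = R^k_ikj, positive on round spheres *)
Definition ricci (g : tensor02) : tensor02 :=
  fun a p => \matrix_(i, j) \sum_k riemann g a k i k j p.

Definition is_einstein (g : tensor02) : Prop :=
  exists Lambda : R, forall a p, chart_dom a p -> ricci g a p = Lambda *: g a p.

Definition conformal (u : M -> R) (g : tensor02) : tensor02 :=
  fun a p => expR (2 * u p) *: g a p.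

Definition lie_fun (X : vfield) (f : M -> R) a p : R :=
  \sum_k X a p ord0 k * pd a k f p.

Definition lie_tensor02 (X : vfield) (T : tensor02) : tensor02 :=
  fun a p => \matrix_(i, j) \sum_k
    (X a p ord0 k * pd a k (fun q => T a q i j) p
     + T a p k j * pd a i (fun q => X a q ord0 k) p
     + T a p i k * pd a j (fun q => X a q ord0 k) p).

(** * Conformal Killing--Yano 2-forms *)

Definition is_smooth_2form (Y : tensor02) : Prop :=
  is_smooth_tensor02 Y /\ forall a p, chart_dom a p -> (Y a p)^T = - Y a p.

(* nabla_c T_ij *)
Definition cov_deriv (g T : tensor02) a c i j p : R :=
  pd a c (fun q => T a q i j) p
  - \sum_k (christoffel g a k c i p * T a p k j
            + christoffel g a k c j p * T a p i k).

(* xi_i = (n - 1)^-1 nabla^k Y_ki *)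
Definition cky_covector (g Y : tensor02) a p : 'rV[R]_n :=
  \row_i ((n.-1)%:R^-1 *
    \sum_k \sum_l invmx (g a p) k l * cov_deriv g Y a l k i p).

(* xi^i = g^ij xi_j *)
Definition cky_field (g Y : tensor02) : vfield :=
  fun a p => cky_covector g Y a p *m (invmx (g a p))^T.

Definition totally_antisym (z : 'I_n -> 'I_n -> 'I_n -> R) : Prop :=
  forall i j k, z i j k = - z j i k /\ z i j k = - z i k j.

(* z is the difference of two tensor fields, so its smoothness and
   transformation law need not be required. *)
Definition is_cky (g Y : tensor02) : Prop :=
  is_smooth_2form Y /\
  exists z : chart_index M -> M -> 'I_n -> 'I_n -> 'I_n -> R,
    (forall a p, chart_dom a p -> totally_antisym (z a p)) /\
    (forall a p, chart_dom a p -> forall c i j,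
       cov_deriv g Y a c i j p =
         g a p c i * cky_covector g Y a p ord0 j
         - g a p c j * cky_covector g Y a p ord0 i
         + z a p c i j).

Definition is_cky_rs (g : tensor02) (u : M -> R) (Y : tensor02) (lambda : R)
    : Prop :=
  [/\ is_cky g Y, smooth_fun u
    & forall a p, chart_dom a p ->
        ricci (conformal u g) a p
        + 2^-1 *: lie_tensor02 (cky_field g Y) (conformal u g) a p
        = lambda *: conformal u g a p].

(** * Flows *)

Definition integral_curve_on (X : vfield) (s0 s1 : R) (gamma : R -> M) : Prop :=
  forall s : R, s0 < s < s1 ->
    {for s, continuous gamma} /\
    (forall a, chart_dom a (gamma s) ->
       is_derive s (1 : R) (chart a \o gamma) (X a (gamma s))).

(* The graph of the maximal local flow Phi of X: Phi_t(p) is defined and equal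
   to q. The flow of X need not be complete. *)
Definition flow_to (X : vfield) (t : R) (p q : M) : Prop :=
  exists s0 s1 gamma,
    [/\ s0 < 0 < s1, s0 < t < s1, integral_curve_on X s0 s1 gamma,
        gamma 0 = p & gamma t = q].

Definition flow_invariant (X : vfield) (f : M -> R) : Prop :=
  forall t p q, flow_to X t p q -> f q = f p.

End Tensors.

Arguments vfield {R n} M.
Arguments tensor02 {R n} M.

(* Main.v *)
Require Import Defs.
From HB Require Import structures.
From mathcomp Require Import all_boot all_order all_algebra.
From mathcomp Require Import all_classical all_reals all_analysis.
From mathcomp Require Import ring.

Import Order.TTheory GRing.Theory Num.Theory.
Import numFieldNormedType.Exports.

Local Open Scope classical_set_scope.
Local Open Scope ring_scope.

(* Along an integral curve gamma of xi one has (phi o gamma)' = alpha phi o gamma,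
   so phi is multiplied by exp (alpha t) under the flow for time t. As phi > 0, a
   periodic orbit forces exp (alpha T) = 1. On a compact M, phi attains its maximum,
   where alpha phi = xi(phi) = 0. *)

Set Implicit Arguments.
Unset Strict Implicit.

(** For small positive [h] the difference quotient has nonpositive numerator. Applied to both [v]
    and [- v], this will force the derivative to vanish at a maximum. *)
Lemma derive_le0_at_local_max (R : realType) (V : normedModType R) (f : V -> R)
  (x v : V) :
  derivable f x v -> (\forall y \near x, f y <= f x) -> 'D_v f x <= 0.
Proof.
move=> fxv fmax.
have hx : h *: v + x @[h --> (0 : R)^'+] --> x.
  apply: cvg_at_right_filter.
  rewrite -[X in _ --> X]add0r -[X in X + _](scale0r v).
  by apply: cvgD; [apply: cvgZr_tmp; exact: cvg_id | exact: cvg_cst].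
have -> : 'D_v f x = lim (h^-1 *: (f (h *: v + x) - f x) @[h --> (0 : R)^'+]).
  exact: (cvg_at_rightE (fun h : R => h^-1 *: (f (h *: v + x) - f x))).
(* The one-sided limit exists because the two-sided one does: [0 < h] implies [h != 0], so the right
   filter refines the punctured one. *)
apply: limr_le.
  apply: cvgP; apply: (cvg_trans _ fxv); apply: cvg_app.
  by move=> A [e e0 Ae]; exists e => // z ze /gt_eqF/negbT; exact: Ae.
have fle := hx _ fmax.
near=> h.
have h0 : 0 < h by near: h; exact: nbhs_right_gt.
rewrite /GRing.scale /= pmulr_rle0 ?invr_gt0// subr_le0.
by near: h.
Unshelve. all: by end_near. Qed.

(** By linearity of the differential. This identifies the coordinate sum in [lie_fun] with a
    directional derivative. *)
Lemma derive_coord (R : realType) (n : nat) (f : 'rV[R]_n -> R)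
  (x v : 'rV[R]_n) :
  differentiable f x -> 'D_v f x = \sum_k v ord0 k * 'D_('e_k) f x.
Proof.
move=> fx; rewrite deriveE // {1}(row_sum_delta v) linear_sum.
by apply: eq_bigr => k _; rewrite linearZ deriveE.
Qed.

(** Chain rule in a chart: by continuity [gamma] stays in the open set [chart_dom a] near [s], so
    there [f \o gamma] factors through [chart a]. *)
Lemma is_derive_integral_curve (R : realType) (n : nat)
  (M : smooth_manifold R n) (X : vfield M) (f : M -> R) (s0 s1 s : R)
  (gamma : R -> M) (a : chart_index M) :
  integral_curve_on X s0 s1 gamma -> s0 < s < s1 -> chart_dom a (gamma s) ->
  differentiable (f \o chart_inv a) (chart a (gamma s)) ->
  is_derive s 1 (f \o gamma) (lie_fun X f a (gamma s)).
Proof.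
move=> hg hs ha df; have [cg /(_ a ha) dg] := hg s hs.
have dgd : differentiable (chart a \o gamma) s by apply/derivable1_diffP.
apply: (@near_eq_is_derive _ _ _ ((f \o chart_inv a) \o (chart a \o gamma))).
  have : \forall t \near s, chart_dom a (gamma t).
    by apply: cg; apply: open_nbhs_nbhs; split => //; exact: chart_dom_open.
  by apply: filterS => t ht /=; rewrite chartK.
have dc : differentiable ((f \o chart_inv a) \o (chart a \o gamma)) s.
  exact: differentiable_comp.
apply: DeriveDef; first exact: diff_derivable.
rewrite deriveE // diff_comp //= -(deriveE _ dgd) (@derive_val _ _ _ _ _ _ _ dg).
by rewrite -deriveE // derive_coord.
Qed.

Lemma is_derive0_const (R : realType) (f : R -> R) (s0 s1 : R) :
  (forall s, s0 < s < s1 -> is_derive s 1 f 0) ->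
  forall x y, s0 < x < s1 -> s0 < y < s1 -> f x = f y.
Proof.
move=> df x y; wlog xy : x y / x <= y => [H hx hy|].
  by have [/H|/ltW/H] := leP x y; [apply|move=> ->].
move=> /andP[x0 x1] /andP[y0 y1].
have dxy z : z \in `[x, y] -> is_derive z 1 f 0.
  rewrite in_itv/= => /andP[xz zy]; apply: df.
  by rewrite (lt_le_trans x0 xz) (le_lt_trans zy y1).
have dxy' z : z \in `]x, y[ -> is_derive z 1 f ((fun=> 0) z).
  by move=> /subset_itv_oo_cc; exact: dxy.
have cf : {within `[x, y], continuous f}.
  by apply: derivable_within_continuous => z /dxy [].
have [c _] := MVT_segment xy dxy' cf.
by rewrite mul0r => /eqP; rewrite subr_eq0 => /eqP.
Qed.

(** Along an integral curve the eigenvalue equation is a linear ODE; the integrating factor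
    [expR (- alpha * s)] turns its solution into a constant. *)
Lemma eigenfunction_along_curve (R : realType) (n : nat)
  (M : smooth_manifold R n) (X : vfield M) (f : M -> R) (alpha : R)
  (df : forall (a : chart_index M) x,
    chart_codom a x -> differentiable (f \o chart_inv a) x)
  (hf : forall (a : chart_index M) p,
    chart_dom a p -> lie_fun X f a p = alpha * f p) (t : R) (p q : M) :
  flow_to X t p q -> f q = expR (alpha * t) * f p.
Proof.
move=> [s0 [s1 [gamma [h0 ht hg <- <-]]]].
pose e (s : R) := expR (- alpha * s).
have : (e * (f \o gamma)) t = (e * (f \o gamma)) 0.
  apply: (@is_derive0_const R _ s0 s1) => // s hs.
  have [a ha] := chart_cover (gamma s).
  have := is_derive_integral_curve hg hs ha (df a _ (chart_in_codom ha)).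
  rewrite hf // => dfg.
  have de : is_derive s 1 e (e s * - alpha).
    apply: (@is_derive1_comp R expR ( *%R (- alpha))).
    have := is_deriveZ (- alpha) (is_derive_id s (1 : R)).
    by rewrite /GRing.scale /= mulr1.
  (* In the product rule the terms with [alpha] and [- alpha] cancel. *)
  apply: (is_derive_eq (is_deriveM de dfg)).
  by rewrite /GRing.scale /=; ring.
rewrite /e !mulrfctE /= mulr0 expR0 mul1r mulNr expRN => <-.
by rewrite mulrA mulfV ?mul1r// gt_eqF// expR_gt0.
Qed.

Lemma differentiable_in_charts_continuous (R : realType) (n : nat)
  (M : smooth_manifold R n) (f : M -> R) :
  (forall (a : chart_index M) x,
    chart_codom a x -> differentiable (f \o chart_inv a) x) ->
  continuous f.
Proof.
move=> df p; have [a ap] := chart_cover p.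
have fE : f p = (f \o chart_inv a) (chart a p) by rewrite /= chartK.
have : (f \o chart_inv a) (chart a q) @[q --> p] --> f p.
  rewrite fE; apply: (continuous_comp (chart_continuous ap)).
  exact/differentiable_continuous/df/chart_in_codom.
apply: cvg_trans; apply: near_eq_cvg.
have : \forall q \near p, chart_dom a q.
  by apply: open_nbhs_nbhs; split => //; exact: chart_dom_open.
by apply: filterS => q aq /=; rewrite chartK.
Qed.

Lemma compact_eigenvalue0 (R : realType) (n : nat) (M : smooth_manifold R n)
  (X : vfield M) (f : M -> R) (alpha : R) :
  [set: M] !=set0 -> compact [set: M] ->
  (forall (a : chart_index M) x,
    chart_codom a x -> differentiable (f \o chart_inv a) x) ->
  (forall p, 0 < f p) ->
  (forall (a : chart_index M) p,
    chart_dom a p -> lie_fun X f a p = alpha * f p) ->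
  alpha = 0.
Proof.
move=> M0 cM df f0 hf.
have [p _ pmax] := compact_EVT_max M0 cM
  (continuous_subspaceT (differentiable_in_charts_continuous df)).
have [a ap] := chart_cover p.
have dfp := df a _ (chart_in_codom ap).
have D0 v : 'D_v (f \o chart_inv a) (chart a p) <= 0.
  apply: derive_le0_at_local_max; first exact: diff_derivable.
  (* The maximum is global, so the bound holds whatever point of [M] the total function
     [chart_inv a] returns. *)
  by near=> y; rewrite /= (chartK ap); apply: pmax; rewrite in_setT.
have : lie_fun X f a p = 0.
  (* [D0] in the direction [X a p] gives one inequality; in the opposite direction, by linearity of
     the differential, it gives the other. *)
  rewrite /lie_fun /pd -derive_coord //; apply/eqP; rewrite eq_le D0 /=.
  by rewrite -oppr_le0 deriveE // -linearN -deriveE.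
by rewrite hf // => /eqP; rewrite mulf_eq0 (gt_eqF (f0 p)) orbF => /eqP.
Unshelve. all: by end_near. Qed.

Unset Implicit Arguments.
Set Strict Implicit.

Theorem mainTheorem5 (R : realType) (n : nat) (hn : (3 <= n)%N)
  (M : smooth_manifold R n)
  (hM0 : [set: M] !=set0) (hMc : connected [set: M])
  (g : tensor02 M) (hg : is_pseudo_metric g) (hE : is_einstein g)
  (Y : tensor02 M) (hY : is_cky g Y)
  (u : M -> R) (lambda : R) (hRS : is_cky_rs g u Y lambda)
  (phi : M -> R) (hphi : forall p, phi p = expR (- u p))
  (alpha : R)
  (halpha : forall (a : chart_index M) (p : M), chart_dom a p ->
     lie_fun (cky_field g Y) phi a p = alpha * phi p) :
  (compact [set: M] -> is_riemannian g ->
     alpha = 0 /\ flow_invariant (cky_field g Y) phi)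
  /\
  ((exists (p0 : M) (T : R), 0 < T /\ flow_to (cky_field g Y) T p0 p0) ->
     alpha = 0 /\ flow_invariant (cky_field g Y) phi).

Proof.
have [_ su _] := hRS.
have dphi (a : chart_index M) x :
    chart_codom a x -> differentiable (phi \o chart_inv a) x.
  (* Smoothness of [u] at order 1 already contains differentiability in the chart. *)
  move=> ax; have [du _] := su a 1%N.
  have -> : phi \o chart_inv a = expR \o (- (u \o chart_inv a)).
    by apply/funext => y /=; rewrite hphi.
  apply: differentiable_comp; first exact/differentiableN/du.
  exact/derivable1_diffP/derivable_expR.
have phi_gt0 p : 0 < phi p by rewrite hphi expR_gt0.
have flow := eigenfunction_along_curve dphi halpha.
have inv : alpha = 0 -> alpha = 0 /\ flow_invariant (cky_field g Y) phi.
  by move=> a0; split=> // t p q /flow ->; rewrite a0 mul0r expR0 mul1r.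
split=> [cM _|[p0 [T [T0 /flow phiT]]]]; apply: inv.
  exact: compact_eigenvalue0 hM0 cM dphi phi_gt0 halpha.
(* Going once around the orbit multiplies [phi p0] by [expR (alpha * T)], and the positive factor
   [phi p0] cancels. *)
have /expR_inj/eqP : expR (alpha * T) = expR 0.
  by rewrite expR0; apply: (mulIf (lt0r_neq0 (phi_gt0 p0))); rewrite mul1r.
by rewrite mulf_eq0 (gt_eqF T0) orbF => /eqP.
Qed.
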